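(* Let $v$ be a vertex in a graph $G$ with neighborhood $N(v)$. If $\chi(G[N(v)])\ge |N(v)|-3$, then $\mathcal{A}(G)>\mathcal{A}(G-v)$.
   Context: All graphs are finite, simple and undirected; $G$ has at least two vertices so that $G-v$ is nonempty. A coloring of a graph $G$ assigns colors to its vertices so that adjacent vertices receive different colors; two colorings are equivalent if they induce the same partition of the vertex set into color classes. $S(G,k)$ denotes the number of non-equivalent colorings of $G$ using exactly $k$ colors. Set $\mathcal{B}(G)=\sum_{k\ge1}S(G,k)$, $\mathcal{T}(G)=\sum_{k\ge1}kS(G,k)$ and $\mathcal{A}(G)=\mathcal{T}(G)/\mathcal{B}(G)$. $G[N(v)]$ is the subgraph induced by $N(v)$, $\chi$ is the chromatic number (with $\chi$ of the graph with no vertices equal to $0$), and $G-v$ is obtained by deleting $v$ and its incident edges. *)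

(* Defs.v *)
From mathcomp Require Import all_boot all_order all_algebra.

Set Implicit Arguments.
Unset Strict Implicit.
Unset Printing Implicit Defensive.

Import Order.TTheory GRing.Theory Num.Theory.

Record sgraph := SGraph {
  vertex :> finType;
  adj : rel vertex;
  adj_sym : symmetric adj;
  adj_irrefl : irreflexive adj
}.

Section Graph.
Variable G : sgraph.

Definition neighborhood (v : G) : {set G} := [set u | adj v u].

Section Induced.
Variable A : {set G}.

Definition induced_adj : rel {x : G | x \in A} :=
  fun x y => adj (val x) (val y).

Lemma induced_adj_sym : symmetric induced_adj.
Proof. by move=> x y; apply: adj_sym. Qed.

Lemma induced_adj_irrefl : irreflexive induced_adj.
Proof. by move=> x; apply: adj_irrefl. Qed.

Definition induced : sgraph := SGraph induced_adj_sym induced_adj_irrefl.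

End Induced.

Definition delete_vertex (v : G) : sgraph := induced (~: [set v]).

Definition coloring (k : nat) (c : {ffun G -> 'I_k}) : bool :=
  [forall x : G, forall y : G, adj x y ==> (c x != c y)].

Definition colorable (k : nat) : bool :=
  [exists c : {ffun G -> 'I_k}, coloring c].

Lemma colorable_card : exists k, colorable k.
Proof.
exists #|G|; apply/existsP; exists [ffun x => enum_rank x].
apply/forallP=> x; apply/forallP=> y; apply/implyP; rewrite !ffunE.
by apply: contraTneq => /enum_rank_inj ->; rewrite adj_irrefl.
Qed.

Definition chi : nat := ex_minn colorable_card.

Definition exact_coloring (k : nat) (c : {ffun G -> 'I_k}) : bool :=
  coloring c && [forall i : 'I_k, i \in codom c].

Definition color_classes (k : nat) (c : {ffun G -> 'I_k}) : {set {set G}} :=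
  preim_partition c [set: G].

(* Equivalent colorings are those with the same [color_classes], so the
   equivalence classes are counted by the distinct values of that map. *)
Definition num_colorings (k : nat) : nat :=
  #|[set color_classes c | c : {ffun G -> 'I_k} & exact_coloring c]|.

(* Justifies truncating the sums over k >= 1 below at k = #|G|. *)
Lemma num_colorings_eq0 (k : nat) : #|G| < k -> num_colorings k = 0.
Proof.
move=> ltGk; apply/eqP; rewrite cards_eq0; apply/set0Pn=> -[P /imsetP[c]].
rewrite inE => /andP[_ /forallP c_onto] _.
have: #|'I_k| <= #|codom c|.
  by apply/subset_leq_card/subsetP=> i _; apply: c_onto.
rewrite card_ord => /leq_trans/(_ (card_size _)).
by rewrite size_codom leqNgt ltGk.
Qed.

Definition total_colorings : nat := \sum_(1 <= k < #|G|.+1) num_colorings k.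
Definition total_colors : nat := \sum_(1 <= k < #|G|.+1) k * num_colorings k.
Definition average_colors : rat := (total_colors%:R / total_colorings%:R)%R.

End Graph.

(* Main.v *)
(* Let H = G - v.  For a partition Q of H into stable sets, write k for its
   number of blocks and s for the number of blocks avoiding N(v).  Then v can be
   added to any of these s blocks, keeping k blocks, or form a new block.  Hence
   B(G) = sum_Q (s + 1) and T(G) = sum_Q (k s + k + 1), and the claim becomes
   sum_(Q, Q') [(k - k') (s - s') + 2] > 0.  The number k - s of blocks meeting
   N(v) lies between chi(G[N(v)]) and |N(v)|, so k - k' and s - s' are integers
   at distance at most 3, and their product is at least -2. *)
Require Import Defs.
From mathcomp Require Import all_boot all_order all_algebra.
From mathcomp Require Import zify ring.

Import Order.TTheory GRing.Theory Num.Theory.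

Set Implicit Arguments.
Unset Strict Implicit.
Unset Printing Implicit Defensive.

(** * Auxiliary facts on set partitions and colorability *)

Lemma setD1_id (T : finType) (A : {set T}) x : x \notin A -> A :\ x = A.
Proof. by move=> /negbTE xA; apply/setDidPl; rewrite disjoint_sym disjoints1 xA. Qed.

Lemma partition_pblock (T : finType) (P : {set {set T}}) (D : {set T}) :
  partition P D -> P = pblock P @: D.
Proof.
move=> partP; have [/eqP defD tiP _] := and3P partP.
apply/setP=> B; apply/idP/imsetP=> [PB | [x Dx ->]]; last first.
  by rewrite pblock_mem ?defD.
have /set0Pn[x Bx] := partition_neq0 partP PB.
exists x; first by rewrite -defD; apply/bigcupP; exists B.
by rewrite (def_pblock tiP PB Bx).
Qed.

Lemma leq_card_partition (T : finType) (P : {set {set T}}) (D : {set T}) :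
  partition P D -> #|P| <= #|D|.
Proof. by move=> /partition_pblock->; apply: leq_imset_card. Qed.

Lemma card_preim_partition (T rT : finType) (f : T -> rT) (D : {set T}) :
  #|preim_partition f D| = #|f @: D|.
Proof.
rewrite /preim_partition /equivalence_partition.
pose F i := [set y in D | i == f y].
rewrite (_ : [set _ | _ in D] = F @: (f @: D)); last by rewrite -imset_comp.
rewrite card_in_imset // => _ _ /imsetP[x Dx ->] /imsetP[y Dy ->] /setP/(_ x).
by rewrite !inE Dx eqxx /= => /esym/eqP.
Qed.

(** Colors may come from any finite type and only those attained are counted. This lets the blocks
    of a partition serve as colors when [chi] is bounded. *)
Lemma colorable_imset (G : sgraph) (T : finType) (f : G -> T) :
  (forall x y, adj x y -> f x != f y) -> colorable G #|f @: [set: G]|.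
Proof.
move=> f_proper; have fT x : f x \in f @: [set: G] by rewrite imset_f.
apply/existsP; exists [ffun x => enum_rank_in (fT x) (f x)].
apply/forallP=> x; apply/forallP=> y; apply/implyP=> /f_proper.
apply: contraNneq; rewrite !ffunE => /(congr1 enum_val).
by rewrite !enum_rankK_in // => ->.
Qed.

Lemma chi_le (G : sgraph) k : colorable G k -> chi G <= k.
Proof. by rewrite /chi; case: ex_minnP => m _ min_m /min_m. Qed.

(** * Colorings up to equivalence as partitions into stable sets *)

Section StablePartitions.
Variable G : sgraph.
Implicit Types (B D : {set G}) (P Q : {set {set G}}).

Definition stable B := [forall x in B, forall y in B, ~~ adj x y].

Lemma stableP B :
  reflect {in B &, forall x y, ~~ adj x y} (stable B).
Proof.
apply: (iffP forall_inP) => [stB x y Bx | stB x Bx].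
  exact: (forall_inP (stB x Bx)).
by apply/forall_inP=> y; apply: stB.
Qed.

Definition stable_partitions D : {set {set {set G}}} :=
  [set P | partition P D && [forall B in P, stable B]].

Lemma stable_partitionsP D P :
  reflect (partition P D /\ {in P, forall B, stable B})
          (P \in stable_partitions D).
Proof.
rewrite inE; apply: (iffP andP) => -[partP stP]; split=> //; exact/forall_inP.
Qed.

(** The fibres of a proper coloring are stable, and surjectivity makes all [k] of them nonempty.
    Conversely, numbering the blocks of a stable partition gives an exact coloring with these blocks
    as classes. *)
Lemma num_colorings_stable k :
  num_colorings G k = #|[set P in stable_partitions setT | #|P| == k]|.
Proof.
rewrite /num_colorings; congr #|pred_of_set _|; apply/setP=> P.
apply/imsetP/setIdP=> [[c] | [/stable_partitionsP[partP stP] /eqP <-{k}]].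
  rewrite inE => /andP[/forallP c_proper /forallP c_onto] ->{P}.
  split; last first.
    rewrite card_preim_partition (_ : c @: _ = setT) ?cardsT ?card_ord //.
    apply/setP=> i; rewrite inE; apply/imsetP.
    by have /codomP[x ->] := c_onto i; exists x.
  apply/stable_partitionsP; split; first exact: preim_partitionP.
  move=> _ /imsetP[z _ ->]; apply/stableP=> x y.
  rewrite !inE /= => /eqP czx /eqP czy.
  by have /forallP/(_ y) := c_proper x; rewrite -czx -czy eqxx implybF.
have [/eqP defT tiP _] := and3P partP.
have PT x : pblock P x \in P by rewrite pblock_mem // defT.
pose c := [ffun x => enum_rank_in (PT x) (pblock P x)].
have eq_c x y : (c x == c y) = (pblock P x == pblock P y).
  apply/eqP/eqP; rewrite !ffunE.
    by move=> /(congr1 enum_val); rewrite !enum_rankK_in.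
  by move=> exy; apply: enum_val_inj; rewrite !enum_rankK_in.
exists c; last first.
  rewrite -[LHS](preim_partition_pblock partP).
  by apply: eq_imset => x; apply/setP=> y; rewrite !inE eq_c.
rewrite inE; apply/andP; split.
  apply/forallP=> x; apply/forallP=> y; apply/implyP; apply: contraTN.
  rewrite eq_c => /eqP exy; apply: (stableP _ (stP _ (PT x))).
    by rewrite mem_pblock defT.
  by rewrite exy mem_pblock defT.
apply/forallP=> i; apply/codomP.
have /imsetP[x _ ei] : enum_val i \in pblock P @: setT.
  by rewrite -(partition_pblock partP) enum_valP.
exists x; rewrite ffunE; apply: enum_val_inj.
by rewrite enum_rankK_in.
Qed.

(** Stable partitions are grouped by their number of blocks. Since the range starts at 1, the graph
    must be nonempty: the empty partition of an empty vertex set would be missed. *)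
Lemma sum_num_colorings (F : nat -> nat) : 0 < #|G| ->
  \sum_(1 <= k < #|G|.+1) F k * num_colorings G k
    = \sum_(P in stable_partitions setT) F #|P|.
Proof.
move=> G_gt0.
transitivity (\sum_(1 <= k < #|G|.+1)
    \sum_(P in stable_partitions setT) if #|P| == k then F k else 0).
  apply: eq_bigr => k _; rewrite -big_mkcondr /= num_colorings_stable.
  rewrite mulnC -sum_nat_const.
  by apply: eq_bigl => P; rewrite !inE.
rewrite exchange_big /=; apply: eq_bigr => P /stable_partitionsP[partP _].
(* For a fixed [P] only the index [k = #|P|] contributes, and it has to be shown to lie in the
   range. *)
rewrite -big_mkcond /= (eq_bigl (fun k => k == #|P|)); last first.
  by move=> k; rewrite eq_sym.
rewrite big_nat1_eq ltnS -cardsT (leq_card_partition partP) andbT.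
case: posnP => // /eqP; rewrite cards_eq0 => /eqP P0.
have /card_gt0P[x _] := G_gt0.
have : x \in cover P by rewrite (cover_partition partP) inE.
by rewrite P0 /cover big_set0 inE.
Qed.

End StablePartitions.

(** * Transfer from an induced subgraph to subsets of the ambient graph *)

(** The vertices of [induced A] form a subtype. Taking images under [val] puts its partitions on the
    carrier of [G], where they can be compared with partitions of the whole graph. *)
Lemma stable_partitions_induced (G : sgraph) (A : {set G}) :
  stable_partitions A =
    (fun P : {set {set induced A}} => [set (val @: B : {set G}) | B : {set induced A} in P])
      @: stable_partitions [set: induced A].
Proof.
have imT : val @: [set: induced A] = A.
  apply/setP=> x; apply/imsetP/idP=> [[y _ ->] | Ax]; first exact: (valP y).
  by exists (Sub x Ax).
have im_st (B : {set induced A}) : stable (val @: B : {set G}) = stable B.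
  apply/stableP/stableP=> stB x y; first by move=> Bx By; apply: stB; apply: imset_f.
  by move=> /imsetP[x' Bx ->] /imsetP[y' By ->]; apply: stB.
have im_part (P : {set {set induced A}}) :
  ([set (val @: B : {set G}) | B : {set induced A} in P] \in stable_partitions A) =
  (P \in stable_partitions [set: induced A]).
  have imP := imset_partition P [set: induced A] (@val_inj _ _ {x | x \in A}).
  rewrite imT in imP; rewrite !inE imP.
  congr (_ && _); apply/forall_inP/forall_inP=> stP B.
    by move=> PB; rewrite -im_st stP ?imset_f.
  by move=> /imsetP[C PC ->]; rewrite im_st stP.
apply/setP=> P; apply/idP/imsetP=> [stP | [Q stQ ->]]; last by rewrite im_part.
have [partP _] := stable_partitionsP _ _ stP.
pose Q : {set {set induced A}} := [set val @^-1: B | B : {set G} in P].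
have defP : [set (val @: B : {set G}) | B : {set induced A} in Q] = P.
  rewrite -imset_comp -[RHS]imset_id; apply: eq_in_imset => B PB /=.
  apply/setP=> x; apply/imsetP/idP=> [[y] | Bx]; first by rewrite inE => By ->.
  have Ax := subsetP (partitionS partP PB) x Bx.
  by exists (Sub x Ax); rewrite ?inE.
by exists Q; rewrite -?im_part defP.
Qed.

Lemma sum_stable_partitions_induced (G : sgraph) (A : {set G}) (F : nat -> nat) :
  \sum_(P in stable_partitions [set: induced A]) F #|P|
    = \sum_(P in stable_partitions A) F #|P|.
Proof.
have inj : injective (fun B : {set induced A} => val @: B : {set G}).
  exact/imset_inj/val_inj.
rewrite [in RHS]stable_partitions_induced big_imset /=; last by move=> P Q _ _ /(imset_inj inj).
by apply: eq_bigr => P _; rewrite card_imset.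
Qed.

(** * Stable partitions of the graph obtained from those of the graph without [v] *)

Section VertexDeletion.
Variables (G : sgraph) (v : G).
Implicit Types (B : {set G}) (P Q : {set {set G}}).

Local Notation N := (neighborhood v).
Local Notation D := (~: [set v]).

(* The blocks of [Q] that [v] may join, with [set0] standing for a new block. *)
Definition joinable Q := set0 |: [set B in Q | [disjoint B & N]].

(** One formula covers both cases: for the empty set it adds the block of [v] alone and removes
    nothing, as a partition does not contain [set0]. *)
Definition join_vertex (QB : {set {set G}} * {set G}) :=
  (v |: QB.2) |: (QB.1 :\ QB.2).

(** The final removal of [set0] discards what is left of the block of [v] when [v] was alone in
    it. *)
Definition remove_vertex P :=
  ((pblock P v :\ v) |: (P :\ pblock P v)) :\ set0.

Lemma notin_joinable Q B :
  partition Q D -> B \in joinable Q -> v \notin B.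
Proof.
move=> partQ /setU1P[-> | /setIdP[QB _]]; first by rewrite inE.
by apply/negP=> /(subsetP (partitionS partQ QB)); rewrite !inE eqxx.
Qed.

Lemma partition_join_vertex Q B :
  partition Q D -> B \in joinable Q -> partition (join_vertex (Q, B)) setT.
Proof.
move=> partQ jB; rewrite /join_vertex /=.
have partQB : partition (Q :\ B) (D :\: B).
  have /setU1P[-> | /setIdP[QB _]] := jB; last exact: partitionD1.
  by rewrite setD0 setD1_id // (partition0 partQ).
rewrite (_ : setT = (v |: B) :|: (D :\: B)); last first.
  by apply/setP=> x; rewrite !inE; case: (x == v); case: (x \in B).
apply: partitionU1 partQB _ _.
  by apply/set0Pn; exists v; rewrite setU11.
rewrite -setI_eq0; apply/eqP/setP=> x; rewrite !inE.
by case: (x == v); case: (x \in B).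
Qed.

Lemma stable_join_vertex Q B :
    Q \in stable_partitions D -> B \in joinable Q ->
  join_vertex (Q, B) \in stable_partitions setT.
Proof.
move=> /stable_partitionsP[partQ stQ] jB; apply/stable_partitionsP.
split; first exact: partition_join_vertex.
move=> _ /setU1P[-> | /setD1P[_ /stQ]] //=.
have [B_N stB] : [disjoint B & N] /\ stable B.
  have /setU1P[-> | /setIdP[/stQ ? ?]] := jB; last by [].
  by split; [rewrite -setI_eq0 set0I | apply/stableP=> x y; rewrite inE].
have vB x : x \in B -> ~~ adj v x.
  by move=> Bx; have := disjointFr B_N Bx; rewrite inE => ->.
apply/stableP=> x y /setU1P[-> | Bx] /setU1P[-> | By].
- by rewrite adj_irrefl.
- exact: vB.
- by rewrite adj_sym vB.
exact: (stableP _ stB).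
Qed.

(** One direction of the bijection: the pair [(Q, B)] can be read off from the joined partition,
    because the block of [v] there determines [B]. *)
Lemma join_vertexK Q B :
    partition Q D -> B \in joinable Q ->
    pblock (join_vertex (Q, B)) v = v |: B
  /\ remove_vertex (join_vertex (Q, B)) = Q.
Proof.
move=> partQ jB; have vB := notin_joinable partQ jB.
have [_ tiJ _] := and3P (partition_join_vertex partQ jB).
have defB : pblock (join_vertex (Q, B)) v = v |: B.
  by apply: (def_pblock tiJ); rewrite ?setU11.
split=> //; rewrite /remove_vertex defB setU1K //.
have vBQ : v |: B \notin Q :\ B.
  apply/setD1P=> -[_ /(partitionS partQ)/subsetP/(_ v)].
  by rewrite setU11 !inE eqxx => /(_ isT).
rewrite /join_vertex /= setU1K //.
apply/setP=> C; rewrite !inE.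
have [-> | nz_C] /= := eqVneq; first by rewrite (partition0 partQ).
(* Only the block [B] itself was taken out and put back; being nonempty here, it is a genuine block
   of [Q]. *)
have [eCB | //] /= := eqVneq; rewrite eCB in nz_C *.
by have /setU1P[B0 | /setIdP[->]] := jB; first by rewrite B0 eqxx in nz_C.
Qed.

(** The other direction of the bijection: every stable partition of [G] arises by joining [v] to the
    rest of its own block, which avoids the neighbors of [v] by stability. *)
Lemma remove_vertexP P : P \in stable_partitions setT ->
  [/\ remove_vertex P \in stable_partitions D,
      pblock P v :\ v \in joinable (remove_vertex P)
    & join_vertex (remove_vertex P, pblock P v :\ v) = P].
Proof.
move=> /stable_partitionsP[partP stP]; have [/eqP defT tiP P0] := and3P partP.
have vP : v \in pblock P v by rewrite mem_pblock defT.
have PC : pblock P v \in P by rewrite pblock_mem ?defT.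
have partPC := partitionD1 partP PC.
have stC := stP _ PC.
rewrite /remove_vertex; move: (pblock P v) vP PC partPC stC => C vC PC partPC stC.
have defC : v |: (C :\ v) = C by rewrite setD1K.
have stB : stable (C :\ v).
  by apply/stableP=> x y /setD1P[_ Cx] /setD1P[_ Cy]; apply: (stableP _ stC).
have BN : [disjoint C :\ v & N].
  rewrite -setI_eq0; apply/eqP/setP=> x; rewrite !inE.
  by apply/negP=> /andP[/andP[_ Cx]]; apply/negP/(stableP _ stC).
have defD : (C :\ v) :|: (setT :\: C) = D.
  by apply/setP=> x; rewrite !inE; have [-> | _] := eqVneq; rewrite ?vC //=; case: (x \in C).
have PC0 : set0 \notin P :\ C by rewrite inE negb_and P0 orbT.
(* If [v] is alone in its block, removing it loses a block; otherwise the block only shrinks. *)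
have [B0 | B0] := eqVneq (C :\ v) set0.
  rewrite B0 in defD defC *.
  have -> : (set0 |: (P :\ C)) :\ set0 = P :\ C by rewrite setU1K.
  split; last by rewrite /join_vertex /= defC setD1_id // setD1K.
    apply/stable_partitionsP; split; first by rewrite -defD set0U.
    by move=> E /setD1P[_ /stP].
  by rewrite setU11.
have disjB : [disjoint C :\ v & setT :\: C].
  by rewrite -setI_eq0; apply/eqP/setP=> x; rewrite !inE; case: (x \in C); rewrite ?andbF.
have partQ : partition ((C :\ v) |: (P :\ C)) D by rewrite -defD; apply: partitionU1.
have -> : ((C :\ v) |: (P :\ C)) :\ set0 = (C :\ v) |: (P :\ C).
  by rewrite setD1_id // (partition0 partQ).
split.
- by apply/stable_partitionsP; split=> // E /setU1P[-> // | /setD1P[_ /stP]].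
- by rewrite in_setU1 inE setU11 BN orbT.
rewrite /join_vertex /= defC setU1K ?setD1K //.
(* The shrunken block is not among the other blocks: it is nonempty and they are disjoint from
   [C]. *)
apply/negP=> /(partitionS partPC)/subsetP sB.
have /set0Pn[x Bx] := B0; have := sB x Bx.
by move: Bx; rewrite !inE => /andP[_ ->].
Qed.

Lemma sum_stable_partitions_join (F : nat -> nat) :
  \sum_(P in @stable_partitions G setT) F #|P|
    = \sum_(Q in stable_partitions D)
        \sum_(B in joinable Q) F #|join_vertex (Q, B)|.
Proof.
rewrite pair_big_dep /=.
rewrite (reindex_onto join_vertex
  (fun P => (remove_vertex P, pblock P v :\ v))) /=; last first.
  by move=> P /remove_vertexP[].
apply: eq_big => [[Q B] | [Q B] _] //=.
apply/andP/andP=> [[stP /eqP[eQ eB]] | [stQ jB]].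
  have [stQ jB _] := remove_vertexP stP.
  by rewrite eQ eB in stQ jB.
have [partQ _] := stable_partitionsP _ _ stQ.
have [defB defQ] := join_vertexK partQ jB.
rewrite stable_join_vertex // defB defQ setU1K ?(notin_joinable partQ) //.
Qed.

Lemma card_join_vertex Q B : partition Q D -> B \in joinable Q ->
  #|join_vertex (Q, B)| = #|Q| + (B == set0).
Proof.
move=> partQ jB; rewrite /join_vertex /= cardsU1.
have -> : v |: B \notin Q :\ B.
  apply/setD1P=> -[_ /(partitionS partQ)/subsetP/(_ v)].
  by rewrite setU11 !inE eqxx => /(_ isT).
have Q0 := partition0 partQ.
have [-> | B0] := eqVneq.
  by rewrite addnC setD1_id // Q0.
have /setU1P[B0' | /setIdP[QB _]] := jB; first by rewrite B0' eqxx in B0.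
by rewrite addn0 [in RHS](cardsD1 B) QB.
Qed.

Definition free_blocks Q := [set B in Q | [disjoint B & N]].

Lemma sum_joinable (F : nat -> nat) Q : partition Q D ->
  \sum_(B in joinable Q) F #|join_vertex (Q, B)|
    = F #|Q|.+1 + #|free_blocks Q| * F #|Q|.
Proof.
move=> partQ; have Q0 := partition0 partQ.
rewrite big_setU1 /=; last by rewrite inE Q0.
rewrite card_join_vertex ?setU11 // eqxx addn1; congr (_ + _).
rewrite -sum_nat_const; apply: eq_bigr => B fB.
have [QB _] := setIdP fB.
rewrite card_join_vertex ?in_setU1 ?fB ?orbT //.
by rewrite (negbTE (partition_neq0 partQ QB)) addn0.
Qed.

(** A block that is not free contains some neighbor [x] of [v], hence is the block of [x]; [v] is
    not its own neighbor, so all neighbors are covered by [Q]. *)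
Lemma card_free_blocks Q : partition Q D ->
  #|Q| = #|free_blocks Q| + #|pblock Q @: N|.
Proof.
move=> partQ; have [/eqP defD tiQ _] := and3P partQ.
rewrite -(cardsID (free_blocks Q) Q); congr (_ + _).
  by congr #|pred_of_set _|; apply/setP=> B; rewrite !inE andbA andbb.
congr #|pred_of_set _|; apply/setP=> B; rewrite !inE.
apply/andP/imsetP=> [[+ QB] | [x Nx ->]].
  rewrite QB -setI_eq0 => /set0Pn[x /setIP[Bx Nx]].
  by exists x; rewrite // (def_pblock tiQ QB Bx).
have Dx : x \in cover Q.
  by rewrite defD !inE; apply: contraTneq Nx => ->; rewrite inE adj_irrefl.
rewrite pblock_mem //=; split=> //; apply/negP=> /disjointFl/(_ Nx).
by rewrite mem_pblock Dx.
Qed.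

(** Coloring each neighbor of [v] by its block is proper, since blocks are stable. *)
Lemma chi_le_pblock Q : Q \in stable_partitions D ->
  chi (induced N) <= #|pblock Q @: N|.
Proof.
move=> /stable_partitionsP[partQ stQ]; have [/eqP defD tiQ _] := and3P partQ.
have imT : pblock Q @: N = (pblock Q \o val) @: [set: induced N].
  apply/setP=> B; apply/imsetP/imsetP=> [[x Nx ->] | [x _ ->]].
    by exists (Sub x Nx).
  by exists (val x); rewrite ?(valP x).
rewrite imT; apply/chi_le/colorable_imset => x y.
apply: contraTneq => /= exy.
have ND z : z \in N -> z \in cover Q.
  by rewrite defD !inE; apply: contraTneq => ->; rewrite adj_irrefl.
have [Qx Qy] : val x \in cover Q /\ val y \in cover Q by rewrite !ND ?(valP x) ?(valP y).
apply: (stableP _ (stQ _ (pblock_mem Qx))); first by rewrite mem_pblock.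
by rewrite exy mem_pblock.
Qed.

End VertexDeletion.

(** * The integer inequality behind the comparison of averages *)

(** If the product is negative, the factors have opposite signs, so their absolute values add up to
    [|x - y|], at most 3. The product of the absolute values is then at most [1 * 2]. *)
Lemma mul_ge_opp2 (x y : int) : (- 3 <= x - y <= 3 -> 0 <= x * y + 2)%R.
Proof.
move=> xy3; have [xy0 | xy0] : (0 <= x * y \/ x * y < 0)%R by lia.
  by lia.
have : (x \in [:: 1; 2; - 1; - 2])%R by rewrite !inE; nia.
by rewrite !inE => /or4P[]/eqP ex; move: xy3; rewrite ex; lia.
Qed.

(* Twice the difference of the two sides is the sum over all pairs [(i, j)] of
   [(k i - k j) * (s i - s j) + 2]; each term is nonnegative because the two
   integer factors differ by at most 3, and the diagonal terms are 2. *)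
Lemma sum_mul_lt_of_range3 (I : finType) (A : {set I}) (k s : I -> int) (a : int) :
    A != set0 -> (forall i, i \in A -> a <= k i - s i <= a + 3)%R ->
  ((\sum_(i in A) k i) * (\sum_(i in A) (s i + 1))
     < (\sum_(i in A) (k i * s i + k i + 1)) * \sum_(i in A) 1)%R.
Proof.
move=> /set0Pn[i0 Ai0] ks_a.
pose e i j : int := ((k i - k j) * (s i - s j) + 2)%R.
have e_ge0 i j : i \in A -> j \in A -> (0 <= e i j)%R.
  move=> /ks_a ri /ks_a rj; apply: mul_ge_opp2; lia.
have e_sum : ((\sum_(i in A) \sum_(j in A) e i j)
    = (\sum_(i in A) (k i * s i + k i + 1)) * (\sum_(i in A) 1) *+ 2
      - (\sum_(i in A) k i) * (\sum_(i in A) (s i + 1)) *+ 2)%R.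
  set ks1 := (\sum_(i in A) (_ * _ + _ + _))%R; set n := (\sum_(i in A) 1)%R.
  set sk := (\sum_(i in A) k i)%R; set s1 := (\sum_(i in A) (s i + 1))%R.
  (* Each product is written in both orders, so that the expanded double sums agree with [e i j]
     term by term; the linear terms cancel. *)
  transitivity (ks1 * n + n * ks1 - (sk * s1 + s1 * sk))%R; last by ring.
  rewrite !big_distrlr /= -!big_split /= -sumrB; apply: eq_bigr => i _.
  rewrite -!big_split /= -sumrB; apply: eq_bigr => j _; rewrite /e; ring.
suff : (0 < \sum_(i in A) \sum_(j in A) e i j)%R by rewrite e_sum; lia.
rewrite (bigD1 i0) //= (bigD1 i0) //= -addrA.
rewrite ltr_pwDl // ?addr_ge0 ?sumr_ge0 // /e; first by rewrite subrr mul0r.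
- by move=> j /andP[Aj _]; apply: e_ge0.
by move=> i /andP[Ai _]; apply: sumr_ge0 => j Aj; apply: e_ge0.
Qed.

Theorem theorem4 (G : sgraph) (v : G) (hG : (1 < #|G|)%N)
  (hchi : (#|neighborhood v|%:Z - 3 <= (chi (induced (neighborhood v)))%:Z)%R) :
  (average_colors (delete_vertex v) < average_colors G)%R.
Proof.
pose S := stable_partitions (~: [set v]).
have partS Q : Q \in S -> partition Q (~: [set v]) by case/stable_partitionsP.
(* This is where a second vertex is needed. *)
have H_gt0 : 0 < #|delete_vertex v| by rewrite card_sig cardsC1; lia.
have cG F := sum_num_colorings F (ltnW hG).
have cH F := sum_num_colorings F H_gt0.
pose s Q := #|free_blocks v Q|.
have tcG : total_colorings G = \sum_(Q in S) (s Q + 1).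
  rewrite /total_colorings; under eq_bigr do rewrite -[num_colorings _ _]mul1n.
  rewrite (cG (fun=> 1)) (sum_stable_partitions_join v (fun=> 1)).
  by apply: eq_bigr => Q /partS partQ; rewrite (sum_joinable (fun=> 1)) // muln1 addnC.
have tkG : total_colors G = \sum_(Q in S) (#|Q| * s Q + #|Q| + 1).
  rewrite /total_colors (cG id) (sum_stable_partitions_join v id).
  by apply: eq_bigr => Q /partS partQ; rewrite (sum_joinable id) // -/(s Q); lia.
have tcH : total_colorings (delete_vertex v) = \sum_(Q in S) 1.
  rewrite /total_colorings; under eq_bigr do rewrite -[num_colorings _ _]mul1n.
  by rewrite (cH (fun=> 1)) (sum_stable_partitions_induced _ (fun=> 1)).
have tkH : total_colors (delete_vertex v) = \sum_(Q in S) #|Q|.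
  by rewrite /total_colors (cH id) (sum_stable_partitions_induced _ id).
have S_nz : S != set0.
  (* The partition into singletons is stable because adjacency is irreflexive. *)
  apply/set0Pn; exists (preim_partition id (~: [set v])).
  apply/stable_partitionsP; split; first exact: preim_partitionP.
  move=> _ /imsetP[z _ ->]; apply/stableP=> x y.
  by rewrite !inE => /andP[_ /eqP <-] /andP[_ /eqP <-]; rewrite adj_irrefl.
have tcH_gt0 : 0 < total_colorings (delete_vertex v).
  by rewrite tcH sum1_card card_gt0.
have tcG_gt0 : 0 < total_colorings G.
  apply: leq_trans tcH_gt0 _; rewrite tcH tcG.
  by apply: leq_sum => Q _; rewrite addn1.
(* Both denominators are positive, so cross-multiplication leaves an inequality of naturals, then
   cast to integers to allow signed differences. *)
rewrite /average_colors ltr_pdivrMr ?ltr0n // mulrAC ltr_pdivlMr ?ltr0n //.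
rewrite -!natrM ltr_nat -ltz_nat !PoszM tcG tcH tkG tkH.
rewrite !(big_morph Posz PoszD (erefl _)) /=.
(* With this lower end of the range, the upper end is [#|neighborhood v|], the trivial bound on the
   number of blocks meeting the neighborhood; [hchi] supplies the lower bound. *)
have := @sum_mul_lt_of_range3 _ S (fun Q => #|Q|) s (#|neighborhood v|%:Z - 3) S_nz.
apply=> Q SQ; have partQ := partS _ SQ.
have := card_free_blocks partQ; have := chi_le_pblock SQ.
have := leq_imset_card (pblock Q) (neighborhood v).
rewrite -/(s Q); lia.
Qed.
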